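(* (1) Let $\lambda,\mu,\varkappa$ be partitions with $\varkappa\prec\lambda$ and $\varkappa\prec\mu$, and let $k\in\mathbb Z_{\ge0}$. The procedure of dragging the cross rightward across the two rows $\lambda/\varkappa$ and $\mu/\varkappa$ (described in the context), which takes $(\lambda,\mu,\varkappa,k)$ and rewrites $\varkappa$ into a new sequence $\nu=(\nu_1,\nu_2,\dots)$ one column at a time by the deterministic weight-preserving matching of the two sides of the Yang--Baxter equation, is well defined and reproduces the local (toggle) rule \[ \nu_1=k+\max(\lambda_1,\mu_1),\qquad \nu_{c+1}=\max(\lambda_{c+1},\mu_{c+1})+\min(\lambda_c,\mu_c)-\varkappa_c\quad(c\ge1). \] (2) Consequently, performing these moves over the $N\times N$ grid produces the Robinson--Schensted--Knuth correspondence. That is, let $(k_{ab})_{1\le a,b\le N}$ be a matrix of nonnegative integers. Set $\Lambda(a,0)=\Lambda(0,b)=\varnothing$ for $0\le a,b\le N$, and for $1\le a,b\le N$ let $\Lambda(a,b)=\nu$ be the output of the procedure in (1) with $\varkappa=\Lambda(a-1,b-1)$, $\lambda=\Lambda(a-1,b)$, $\mu=\Lambda(a,b-1)$, $k=k_{ab}$. Then the tableau in which the boxes of $\Lambda(a,N)/\Lambda(a-1,N)$ are filled with $a$ ($1\le a\le N$) and the tableau in which the boxes of $\Lambda(N,b)/\Lambda(N,b-1)$ are filled with $b$ ($1\le b\le N$) are, respectively, the insertion tableau $P$ and the recording tableau $Q$ of the classical (row insertion) RSK correspondence applied to $(k_{ab})$.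
   Context: Partitions are weakly decreasing sequences of nonnegative integers $\lambda=(\lambda_1\ge\lambda_2\ge\cdots)$ with finitely many nonzero terms. $\mu\prec\lambda$ means $\lambda_1\ge\mu_1\ge\lambda_2\ge\mu_2\ge\cdots$ (i.e. $\lambda/\mu$ is a horizontal strip). Vertex weights (arguments in $\mathbb Z_{\ge0}$; $x,y$ independent indeterminates; $\mathbf 1$ is the indicator): $W_x(i_1,j_1;i_2,j_2)=\mathbf 1_{i_1+j_1=i_2+j_2}\mathbf 1_{i_1\ge j_2}x^{j_2}$, $W^*_y(i_1,j_1;i_2,j_2)=\mathbf 1_{i_2+j_1=i_1+j_2}\mathbf 1_{i_2\ge j_2}y^{j_2}$, and the cross $\mathbb R_{x,y}(i_1,j_1;i_2,j_2)=\mathbf 1_{i_1+j_2=j_1+i_2}(xy)^{\min(i_2,j_2)}$. For boundary data $i_1,i_2,i_3,j_1,j_2,j_3\in\mathbb Z_{\ge0}$ with $i_1+j_2+j_3=i_2+i_3+j_1$, they satisfy the Yang--Baxter equation \[ \sum_{k_1,k_2,k_3\ge0}\mathbb R_{x,y}(i_2,i_1;k_2,k_1)W_x(k_3,k_2;j_3,j_2)W^*_y(i_3,k_1;k_3,j_1)=\sum_{k_1',k_2',k_3'\ge0}W_x(i_3,i_2;k_3',k_2')W^*_y(k_3',i_1;j_3,k_1')\mathbb R_{x,y}(k_2',k_1';j_2,j_1). \] On the left $k_2=i_2+k_1-i_1$, $k_3=i_3+j_1-k_1$, and on the right $k_2'=k_1'+j_2-j_1$, $k_3'=j_3+i_1-k_1'$.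 Nonzero summands occur exactly for $\max(0,i_1-i_2)\le k_1\le\min(i_3,i_3+j_1-j_2)$ on the left and $\max(0,j_1-j_2)\le k_1'\le\min(j_3,j_3+i_1-i_2)$ on the right. The deterministic move sends the left state $k_1$ to the right state $k_1'$ by the unique weight-preserving bijection between these nonzero summands, $k_1'=j_1-\min(j_1,j_2)+\min(k_1,k_2)$; equivalently $k_3'=k_3+\max(i_1,i_2)-\max(j_1,j_2)$. Dragging procedure for $(\lambda,\mu,\varkappa,k)$. Column $0$ (carrying infinitely many vertical arrows, so that a vertex of parameter $z$ there has weight $z^{j_2}$, where $j_2$ is the number of arrows leaving it to the right, with no constraint relating vertical and horizontal occupations): with arbitrary incoming occupations $i_1,i_2\ge0$ to the cross, the cross has outgoing occupations $k_2$ on its $x$-line and $k_1$ on its $y$-line with $\min(k_1,k_2)=k$. The occupations on the far right are $j_2=\mu_1-\varkappa_1$ (on the $x$-line) and $j_1=\lambda_1-\varkappa_1$ (on the $y$-line). The left state has weight $(xy)^kx^{j_2}y^{j_1}$; it is matched with the right state, determined by $k_1',k_2'\ge0$ with $k_2'+j_1=k_1'+j_2$, of equal weight $x^{k_2'}y^{k_1'}(xy)^{\min(j_1,j_2)}$. Then $\nu_1$ is defined by $k_1'=\nu_1-\mu_1$, equivalently $k_2'=\nu_1-\lambda_1$. Column $c\ge1$: once $\nu_c$ is known, apply the deterministic move with boundary data \[ i_1=\nu_c-\mu_c,\quad i_2=\nu_c-\lambda_c,\quad i_3=\lambda_c-\lambda_{c+1},\quad j_3=\mu_c-\mu_{c+1},\quad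 j_1=\lambda_{c+1}-\varkappa_{c+1},\quad j_2=\mu_{c+1}-\varkappa_{c+1} \] to the left state with $k_3=\varkappa_c-\varkappa_{c+1}$, and define $\nu_{c+1}$ by $k_3'=\nu_c-\nu_{c+1}$. Classical RSK for $(k_{ab})$: form the biword containing each pair $\binom{b}{a}$ exactly $k_{ab}$ times, the pairs ordered by increasing $b$ and, for equal $b$, by weakly increasing $a$. Reading left to right, row insert each lower letter $a$ into $P$ (Schensted row insertion: $a$ replaces the leftmost entry strictly greater than $a$ in the row, or is appended at the end of the row if there is none; the replaced entry is inserted into the next row), and record the corresponding upper letter $b$ in $Q$ in the box newly added to the shape. *)

(* Defs.v *)
From mathcomp Require Import all_boot all_order all_algebra.

Set Implicit Arguments.
Unset Strict Implicit.
Unset Printing Implicit Defensive.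

(* A sequence (l_1, l_2, ...) is a function l : nat -> nat shifted by one:
   [l c] stands for l_{c+1}. *)
Definition is_partition (l : nat -> nat) : Prop :=
  (forall c, l c.+1 <= l c) /\ (exists n, forall c, n <= c -> l c = 0).

(* m \prec l *)
Definition interlace (m l : nat -> nat) : Prop :=
  forall c, m c <= l c /\ l c.+1 <= m c.

Section VertexWeights.

Local Open Scope ring_scope.

Variables (R : comNzRingType) (x y : R).

Definition weightW (i1 j1 i2 j2 : nat) : R :=
  (i1 + j1 == i2 + j2)%N%:R * (j2 <= i1)%N%:R * x ^+ j2.

Definition weightWs (i1 j1 i2 j2 : nat) : R :=
  (i2 + j1 == i1 + j2)%N%:R * (j2 <= i2)%N%:R * y ^+ j2.

Definition weightR (i1 j1 i2 j2 : nat) : R :=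
  (i1 + j2 == j1 + i2)%N%:R * (x * y) ^+ minn i2 j2.

End VertexWeights.

(* Weights live in Z[x, y], encoded as Z[x][y]. *)
Notation Zxy := {poly {poly int}}.
Definition varx : Zxy := ('X%:P)%R.
Definition vary : Zxy := 'X%R.

Record boundary := Boundary {
  bi1 : nat; bi2 : nat; bi3 : nat; bj1 : nat; bj2 : nat; bj3 : nat }.

Definition conserved (B : boundary) : Prop :=
  bi1 B + bj2 B + bj3 B = bi2 B + bi3 B + bj1 B.

(* The summands of the two sides of the Yang-Baxter equation, indexed by the
   internal occupations (k1, k2, k3). *)
Definition ybe_state := (nat * nat * nat)%type.

Definition ybe_lhs (B : boundary) (s : ybe_state) : Zxy :=
  let: (k1, k2, k3) := s in
  (weightR varx vary (bi2 B) (bi1 B) k2 k1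
   * weightW varx k3 k2 (bj3 B) (bj2 B)
   * weightWs vary (bi3 B) k1 k3 (bj1 B))%R.

Definition ybe_rhs (B : boundary) (t : ybe_state) : Zxy :=
  let: (k1, k2, k3) := t in
  (weightW varx (bi3 B) (bi2 B) k3 k2
   * weightWs vary k3 (bi1 B) (bj3 B) k1
   * weightR varx vary k2 k1 (bj2 B) (bj1 B))%R.

(* The same in column 0, where a vertex of parameter z weighs z ^+ j2 and only
   the occupations (k1, k2) of the two horizontal lines are internal. *)
Definition ybe0_state := (nat * nat)%type.

Definition ybe0_lhs (i1 i2 j1 j2 : nat) (s : ybe0_state) : Zxy :=
  let: (k1, k2) := s in
  (weightR varx vary i2 i1 k2 k1 * varx ^+ j2 * vary ^+ j1)%R.

Definition ybe0_rhs (j1 j2 : nat) (t : ybe0_state) : Zxy :=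
  let: (k1, k2) := t in
  (varx ^+ k2 * vary ^+ k1 * weightR varx vary k2 k1 j2 j1)%R.

(* f restricts to a weight-preserving bijection from the states of nonzero
   weight for A onto those of nonzero weight for B. *)
Definition weight_bij (S T : Type) (A : S -> Zxy) (B : T -> Zxy)
    (f : S -> T) : Prop :=
  [/\ forall s, A s != 0%R -> B (f s) = A s,
      forall s s', A s != 0%R -> A s' != 0%R -> f s = f s' -> s = s'
    & forall t, B t != 0%R -> exists2 s, A s != 0%R & f s = t].

(* The state s is sent to t by the unique weight-preserving bijection. *)
Definition det_move (S T : Type) (A : S -> Zxy) (B : T -> Zxy)
    (s : S) (t : T) : Prop :=
  A s != 0%R /\
  exists f : S -> T,
    [/\ weight_bij A B f,
        forall g, weight_bij A B g -> forall u, A u != 0%R -> g u = f u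
      & f s = t].

(* In the two steps below, differences of parts are written additively: natural
   number subtraction would hide a negative occupation. *)

(* [drag_first i1 i2 la mu ka k n] : column 0, with incoming occupations i1, i2
   of the cross, outputs n as the first part of the new sequence. *)
Definition drag_first (i1 i2 : nat) (la mu ka : nat -> nat) (k n : nat)
    : Prop :=
  exists j1 j2 k1 k2 k1' k2' : nat,
    [/\ la 0 = ka 0 + j1 /\ mu 0 = ka 0 + j2,
        minn k1 k2 = k,
        det_move (ybe0_lhs i1 i2 j1 j2) (ybe0_rhs j1 j2) (k1, k2) (k1', k2')
      & n = mu 0 + k1'].

(* [drag_column la mu ka c n n'] : if n = nu c, the next column outputs
   n' = nu c.+1. *)
Definition drag_column (la mu ka : nat -> nat) (c n n' : nat) : Prop :=
  exists (B : boundary) (k1 k2 k3 k1' k2' k3' : nat),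
    [/\ [/\ n = mu c + bi1 B, n = la c + bi2 B & la c = la c.+1 + bi3 B],
        [/\ mu c = mu c.+1 + bj3 B, la c.+1 = ka c.+1 + bj1 B
          & mu c.+1 = ka c.+1 + bj2 B],
        conserved B /\ ka c = ka c.+1 + k3,
        det_move (ybe_lhs B) (ybe_rhs B) (k1, k2, k3) (k1', k2', k3')
      & n = n' + k3'].

Definition drag (i1 i2 : nat) (la mu ka : nat -> nat) (k : nat)
    (nu : nat -> nat) : Prop :=
  drag_first i1 i2 la mu ka k (nu 0) /\
  forall c, drag_column la mu ka c (nu c) (nu c.+1).

(* L a b is the partition Lambda(a, b).  The cell (a, b), 1 <= a, b <= N, reads
   the entry k a b and is dragged with incoming occupations i1 a b, i2 a b. *)
Definition drag_grid (N : nat) (i1 i2 k : nat -> nat -> nat)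
    (L : nat -> nat -> nat -> nat) : Prop :=
  [/\ forall a c, a <= N -> L a 0 c = 0,
      forall b c, b <= N -> L 0 b c = 0
    & forall a b, 1 <= a <= N -> 1 <= b <= N ->
      drag (i1 a b) (i2 a b) (L a.-1 b) (L a b.-1) (L a.-1 b.-1) (k a b)
        (L a b)].

(* Rows are listed from top to bottom, entries from left to right. *)
Definition tableau := seq (seq nat).

(* Schensted insertion into one row, with the replaced entry if any. *)
Fixpoint row_insert (a : nat) (r : seq nat) : seq nat * option nat :=
  match r with
  | [::] => ([:: a], None)
  | z :: r' =>
      if a < z then (a :: r', Some z)
      else let: (r'', o) := row_insert a r' in (z :: r'', o)
  end.

(* The second component is the index of the row that receives a new box. *)
Fixpoint tab_insert (a : nat) (P : tableau) : tableau * nat :=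
  match P with
  | [::] => ([:: [:: a]], 0)
  | r :: P' =>
      let: (r', o) := row_insert a r in
      match o with
      | None => (r' :: P', 0)
      | Some z => let: (P'', i) := tab_insert z P' in (r' :: P'', i.+1)
      end
  end.

Definition record_entry (b i : nat) (Q : tableau) : tableau :=
  set_nth [::] Q i (rcons (nth [::] Q i) b).

(* Pairs (b, a): upper letter first. *)
Definition biword (N : nat) (k : nat -> nat -> nat) : seq (nat * nat) :=
  flatten [seq flatten [seq nseq (k a b) (b, a) | a <- iota 1 N]
          | b <- iota 1 N].

Definition rsk_step (PQ : tableau * tableau) (ba : nat * nat)
    : tableau * tableau :=
  let: (P', i) := tab_insert ba.2 PQ.1 in (P', record_entry ba.1 i PQ.2).

Definition rsk (N : nat) (k : nat -> nat -> nat) : tableau * tableau :=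
  foldl rsk_step ([::], [::]) (biword N k).

(* The boxes of T are those of the M a / M a.-1 (1 <= a <= N), and the boxes of
   M a / M a.-1 contain a. *)
Definition filled_by (N : nat) (M : nat -> nat -> nat) (T : tableau) : Prop :=
  forall r c a,
    onth (nth [::] T r) c = Some a <-> (1 <= a <= N) /\ (M a.-1 r <= c < M a r).

(* Main.v *)
(* Each side of the Yang-Baxter equation has nonzero summands that are pairwise
   distinct monomials, so the weight-preserving bijection is unique and is read
   off from the exponents; this gives the toggle rule.

   For RSK, let m a be the number of entries at most a in a given row of the
   insertion tableau.  Row inserting a letter z into a weakly increasing row
   leaves m a unchanged for a < z and replaces it by max (m a) (m z + 1) for
   z <= a.  Hence inserting a weakly increasing word w gives
   m' a = (multiplicity of a in w) + max (m' (a - 1)) (m a), and the bumped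
   letters again form a weakly increasing word, in which a has multiplicity
   min (m' (a - 1)) (m a) - m (a - 1).  Inserting the bumped word into the next
   row yields the toggle rule row after row. *)
Require Import Defs.
From mathcomp Require Import all_boot all_order all_algebra.
From mathcomp Require Import zify ring.

Set Implicit Arguments.
Unset Strict Implicit.
Unset Printing Implicit Defensive.

(** * The deterministic move *)

Section DeterministicMove.

Import GRing.Theory.
Local Open Scope ring_scope.

Definition mono (p q : nat) : Zxy := varx ^+ p * vary ^+ q.

Lemma mono_neq0 p q : mono p q != 0.
Proof.
by rewrite mulf_neq0 // expf_neq0 ?polyX_eq0 // polyC_eq0 polyX_eq0.
Qed.

(** The exponent of $y$ is the degree in the outer variable, and the exponent of $x$ is the degree
    of the leading coefficient. *)
Lemma mono_inj p q p' q' : mono p q = mono p' q' -> p = p' /\ q = q'.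
Proof.
have monoE i j : mono i j = ('X^i : {poly int}) *: 'X^j :> Zxy.
  by rewrite /mono /varx -rmorphXn /= mul_polyC.
have Xn0 (i : nat) : 'X^i != 0 :> {poly int} by rewrite expf_neq0 ?polyX_eq0.
rewrite !monoE => e; have eq_q : q = q'.
  by apply: succn_inj; rewrite -!(size_polyXn {poly int}) -(size_scale _ (Xn0 p))
    e size_scale.
split=> //; move/(congr1 (fun r : Zxy => r`_q)): e.
rewrite eq_q !coefZ coefXn eqxx !mulr1.
move=> /(congr1 (fun r : {poly int} => size r)).
by rewrite !size_polyXn => -[].
Qed.

(** When a nonzero weight determines its state on either side, a weight-preserving map is forced, so
    the move is computed by any explicit [f]. The map [g] supplies surjectivity. *)
Lemma det_moveP (S T : Type) (A : S -> Zxy) (B : T -> Zxy) f g s t :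
    (forall s, A s != 0 -> B (f s) = A s) ->
    (forall t, B t != 0 -> A (g t) = B t) ->
    (forall s s', A s != 0 -> A s = A s' -> s = s') ->
    (forall t t', B t != 0 -> B t = B t' -> t = t') ->
  det_move A B s t <-> A s != 0 /\ t = f s.
Proof.
move=> fP gP injA injB.
have uniq_f h u : weight_bij A B h -> A u != 0 -> h u = f u.
  by case=> hP _ _ Au; apply: injB; rewrite ?fP ?hP.
split=> [[As [h [hP _ <-]]] | [As ->]]; first by rewrite (uniq_f h).
have bij_f : weight_bij A B f.
  split=> // [u u' Au Au' fu | u Bu].
    by apply: injA; rewrite // -(fP u) // fu fP.
  have Agu : A (g u) != 0 by rewrite gP.
  by exists (g u) => //; symmetry; apply: injB; rewrite // fP ?gP.
by split=> //; exists f; split=> // h hP u; apply: uniq_f.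
Qed.

(** Both sides of the equation, in every column, are indicators times monomials. Nonvanishing and
    equality of weights thereby become linear arithmetic. *)
Lemma boolmono_neq0 (b : bool) p q : (b%:R * mono p q != 0) = b.
Proof. by case: b; rewrite ?mul1r ?mul0r ?mono_neq0 ?eqxx. Qed.

Lemma boolmono_inj (b b' : bool) p q p' q' :
    b%:R * mono p q != 0 -> b%:R * mono p q = b'%:R * mono p' q' ->
  [/\ b, b', p = p' & q = q'].
Proof.
rewrite boolmono_neq0 => -> /= e.
have b't : b' by rewrite -(boolmono_neq0 b' p' q') -e mul1r mono_neq0.
by move: e; rewrite b't !mul1r => /mono_inj[-> ->].
Qed.

Lemma ybe0_lhsE i1 i2 j1 j2 k1 k2 :
  ybe0_lhs i1 i2 j1 j2 (k1, k2)
  = (i2 + k1 == i1 + k2)%N%:R * mono (minn k2 k1 + j2) (minn k2 k1 + j1).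
Proof.
rewrite /ybe0_lhs /weightR /mono !exprD exprMn; move: varx vary => x y; ring.
Qed.

Lemma ybe0_rhsE j1 j2 k1 k2 :
  ybe0_rhs j1 j2 (k1, k2)
  = (k2 + j1 == k1 + j2)%N%:R * mono (minn j2 j1 + k2) (minn j2 j1 + k1).
Proof.
rewrite /ybe0_rhs /weightR /mono !exprD exprMn; move: varx vary => x y; ring.
Qed.

Lemma ybe_lhsE B k1 k2 k3 :
  ybe_lhs B (k1, k2, k3)
  = [&& bi2 B + k1 == bi1 B + k2, k3 + k2 == bj3 B + bj2 B, bj2 B <= k3,
        k3 + k1 == bi3 B + bj1 B & bj1 B <= k3]%N%:R
    * mono (minn k2 k1 + bj2 B) (minn k2 k1 + bj1 B).
Proof.
rewrite /ybe_lhs /weightR /weightW /weightWs /mono !exprD exprMn.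
move: varx vary => x y.
by do 3 case: (_ == _)%N; do 2 case: (_ <= _)%N; rewrite /=; ring.
Qed.

Lemma ybe_rhsE B k1 k2 k3 :
  ybe_rhs B (k1, k2, k3)
  = [&& bi3 B + bi2 B == k3 + k2, k2 <= bi3 B, bj3 B + bi1 B == k3 + k1,
        k1 <= bj3 B & k2 + bj1 B == k1 + bj2 B]%N%:R
    * mono (minn (bj2 B) (bj1 B) + k2) (minn (bj2 B) (bj1 B) + k1).
Proof.
rewrite /ybe_rhs /weightR /weightW /weightWs /mono !exprD exprMn.
move: varx vary => x y.
by do 3 case: (_ == _)%N; do 2 case: (_ <= _)%N; rewrite /=; ring.
Qed.

Local Arguments ybe0_lhs : simpl never.
Local Arguments ybe0_rhs : simpl never.
Local Arguments ybe_lhs : simpl never.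
Local Arguments ybe_rhs : simpl never.

(** Conservation fixes the difference of the two occupations on each side, leaving only their
    minimum free. Comparing exponents gives $\min(k_1,k_2)+j_1=\min(j_1,j_2)+k_1'$ and the same for
    index 2; truncated differences are excesses over the minimum. *)
Lemma det_move0P i1 i2 j1 j2 k1 k2 t :
  det_move (ybe0_lhs i1 i2 j1 j2) (ybe0_rhs j1 j2) (k1, k2) t <->
  (i2 + k1 = i1 + k2)%N /\
  t = ((minn k1 k2 + (j1 - j2)), (minn k1 k2 + (j2 - j1)))%N.
Proof.
pose f (s : ybe0_state) :=
  (minn s.1 s.2 + (j1 - j2), minn s.1 s.2 + (j2 - j1))%N.
(* The inverse of [f]: [m] recovers the minimum, and the excesses of [i1], [i2] restore conservation
   at the left cross. *)
pose g (t : ybe0_state) :=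
  let m := (t.1 - (j1 - j2))%N in (m + (i1 - i2), m + (i2 - i1))%N.
rewrite (@det_moveP _ _ _ _ f g) ?ybe0_lhsE ?boolmono_neq0 /f /g /=.
- by split=> -[/eqP].
- move=> [u1 u2]; rewrite ybe0_lhsE ybe0_rhsE boolmono_neq0 /= => h.
  by congr ((nat_of_bool _)%:R * mono _ _); move: h; lia.
- move=> [u1 u2]; rewrite ybe0_lhsE ybe0_rhsE boolmono_neq0 /= => h.
  by congr ((nat_of_bool _)%:R * mono _ _); move: h; lia.
- move=> [u1 u2] [v1 v2]; rewrite !ybe0_lhsE => /boolmono_inj /[apply] -[*].
  by congr pair; lia.
- move=> [u1 u2] [v1 v2]; rewrite !ybe0_rhsE => /boolmono_inj /[apply] -[*].
  by congr pair; lia.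
Qed.

(** The exponents are compared as in column 0, and conservation at the starred vertex then gives
    $k_3'=j_3+i_1-k_1'$. On a state of nonzero weight this subtraction does not truncate. *)
Lemma det_move_columnP B k1 k2 k3 t : conserved B ->
  det_move (ybe_lhs B) (ybe_rhs B) (k1, k2, k3) t <->
  [&& bi2 B + k1 == bi1 B + k2, k3 + k2 == bj3 B + bj2 B, bj2 B <= k3,
      k3 + k1 == bi3 B + bj1 B & bj1 B <= k3]%N /\
  t = ((minn k1 k2 + (bj1 B - bj2 B)), (minn k1 k2 + (bj2 B - bj1 B)),
       (bj3 B + bi1 B - (minn k1 k2 + (bj1 B - bj2 B))))%N.
Proof.
rewrite /conserved => consB.
pose f (s : ybe_state) := let u1 := s.1.1 in let u2 := s.1.2 in
  (minn u1 u2 + (bj1 B - bj2 B), minn u1 u2 + (bj2 B - bj1 B),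
   bj3 B + bi1 B - (minn u1 u2 + (bj1 B - bj2 B)))%N.
pose g (t : ybe_state) := let u1 := t.1.1 in
  let m := (u1 - (bj1 B - bj2 B))%N in
  (m + (bi1 B - bi2 B), m + (bi2 B - bi1 B),
   bi3 B + bj1 B - (m + (bi1 B - bi2 B)))%N.
rewrite (@det_moveP _ _ _ _ f g) ?ybe_lhsE ?boolmono_neq0 /f /g //=.
- move=> [[u1 u2] u3]; rewrite ybe_lhsE ybe_rhsE boolmono_neq0 /= => h.
  by congr ((nat_of_bool _)%:R * mono _ _); move: h; lia.
- move=> [[u1 u2] u3]; rewrite ybe_lhsE ybe_rhsE boolmono_neq0 /= => h.
  by congr ((nat_of_bool _)%:R * mono _ _); move: h; lia.
- move=> [[u1 u2] u3] [[v1 v2] v3].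
  rewrite !ybe_lhsE => /boolmono_inj /[apply] -[*].
  by congr (_, _, _); lia.
- move=> [[u1 u2] u3] [[v1 v2] v3].
  rewrite !ybe_rhsE => /boolmono_inj /[apply] -[*].
  by congr (_, _, _); lia.
Qed.

End DeterministicMove.

(** * The toggle rule *)

(** The subtraction is exact under interlacing, where [ka c] is at most [la c] and [mu c]. *)
Definition local_rule (la mu ka : nat -> nat) (k : nat) (nu : nat -> nat) :=
  nu 0 = k + maxn (la 0) (mu 0) /\
  forall c, nu c.+1 = maxn (la c.+1) (mu c.+1) + minn (la c) (mu c) - ka c.

Lemma drag_firstP i1 i2 (la mu ka : nat -> nat) k n :
    ka 0 <= la 0 -> ka 0 <= mu 0 ->
  drag_first i1 i2 la mu ka k n <-> n = k + maxn (la 0) (mu 0).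
Proof.
move=> le_la le_mu; split=> [|->].
  case=> j1 [j2 [k1 [k2 [k1' [k2' [[ela emu] mk /det_move0P[ek [-> _]] ->]]]]]].
  by lia.
set j1 := la 0 - ka 0; set j2 := mu 0 - ka 0.
(* The only pair with minimum [k] and the difference imposed by the cross. *)
exists j1, j2, (k + (i1 - i2)), (k + (i2 - i1)).
exists (k + (j1 - j2)), (k + (j2 - j1)).
split; [lia | lia | | lia].
by apply/det_move0P; split; [lia | congr pair; lia].
Qed.

(** Since $k_3'=j_3+i_1-k_1'$, the input [n] cancels and [n'] is [mu c.+1] plus $k_1'$. The bound on
    [n] makes the occupations [bi1] and [bi2] of the witness exact differences. *)
Lemma drag_columnP (la mu ka : nat -> nat) c n n' :
    interlace ka la -> interlace ka mu -> maxn (la c) (mu c) <= n ->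
  drag_column la mu ka c n n' <->
  n' = maxn (la c.+1) (mu c.+1) + minn (la c) (mu c) - ka c.
Proof.
move=> kala kamu le_n.
have [[la1 la2] [mu1 mu2]] := (kala c, kamu c).
have [[la3 _] [mu3 _]] := (kala c.+1, kamu c.+1).
split=> [|->].
  case=> B [k1 [k2 [k3 [k1' [k2' [k3' []]]]]]].
  case=> e1 e2 e3 [e4 e5 e6] [consB e7] /(det_move_columnP _ _ _ _ consB)[h].
  by case=> e8 e9 e10 e11; move: h; lia.
pose B := Boundary (n - mu c) (n - la c) (la c - la c.+1)
  (la c.+1 - ka c.+1) (mu c.+1 - ka c.+1) (mu c - mu c.+1).
(* Forced by conservation at the two left vertices: $i_3+j_1-k_3$ and $j_3+j_2-k_3$ telescope to
   these values. *)
pose k1 := la c - ka c; pose k2 := mu c - ka c.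
have consB : conserved B by rewrite /conserved /=; lia.
exists B, k1, k2, (ka c - ka c.+1).
exists (minn k1 k2 + (bj1 B - bj2 B)), (minn k1 k2 + (bj2 B - bj1 B)).
exists (bj3 B + bi1 B - (minn k1 k2 + (bj1 B - bj2 B))).
split; rewrite /= /k1 /k2; last by lia.
- by split; lia.
- by split; lia.
- by split=> //; lia.
by apply/det_move_columnP => //=; split=> //; apply/and5P; split; lia.
Qed.

Lemma local_rule_ge la mu ka k nu c :
  interlace ka la -> interlace ka mu -> local_rule la mu ka k nu ->
  maxn (la c) (mu c) <= nu c.
Proof.
move=> kala kamu [nu0 nuS]; case: c => [|c]; first by rewrite nu0 leq_addl.
by rewrite nuS; have [[? ?] [? ?]] := (kala c, kamu c); lia.
Qed.

Lemma dragP i1 i2 la mu ka k nu :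
  interlace ka la -> interlace ka mu ->
  drag i1 i2 la mu ka k nu <-> local_rule la mu ka k nu.
Proof.
move=> kala kamu; have [[la0 _] [mu0 _]] := (kala 0, kamu 0).
split=> [[d0 dS] | nuP].
  have nu0 : nu 0 = k + maxn (la 0) (mu 0) by move/drag_firstP: d0; apply.
  (* The rule for a column needs a bound on its input, which comes from the preceding column; both
     are proved in one induction. *)
  suffices nuS c : maxn (la c) (mu c) <= nu c /\
      nu c.+1 = maxn (la c.+1) (mu c.+1) + minn (la c) (mu c) - ka c.
    by split=> // c; case: (nuS c).
  elim: c => [|c [ge_nu nuS]].
    have ge_nu : maxn (la 0) (mu 0) <= nu 0 by rewrite nu0 leq_addl.
    by split=> //; apply/(drag_columnP _ kala kamu ge_nu).
  have ge_nu' : maxn (la c.+1) (mu c.+1) <= nu c.+1.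
    by rewrite nuS; have [[? ?] [? ?]] := (kala c, kamu c); lia.
  by split=> //; apply/(drag_columnP _ kala kamu ge_nu').
have ge_nu c := local_rule_ge c kala kamu nuP.
case: (nuP) => nu0 nuS; split; first exact/drag_firstP.
by move=> c; apply/(drag_columnP _ kala kamu (ge_nu c)).
Qed.

(** The upper bound [nu c.+1 <= minn (la c) (mu c)] holds because [la c.+1] and [mu c.+1] are at
    most [ka c]. *)
Lemma local_rule_interlace la mu ka k nu :
  interlace ka la -> interlace ka mu -> local_rule la mu ka k nu ->
  interlace la nu /\ interlace mu nu.
Proof.
move=> kala kamu nuP; have ge_nu c := local_rule_ge c kala kamu nuP.
case: nuP => _ nuS; split=> c; have := ge_nu c; have := nuS c.
  by have [[? ?] [? ?]] := (kala c, kamu c); lia.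
by have [[? ?] [? ?]] := (kala c, kamu c); lia.
Qed.

Lemma local_rule_partition la mu ka k nu :
  is_partition la -> is_partition mu -> interlace ka la -> interlace ka mu ->
  local_rule la mu ka k nu -> is_partition nu.
Proof.
move=> [_ [m la0]] [_ [n mu0]] kala kamu nuP.
have [lanu munu] := local_rule_interlace kala kamu nuP; split=> [c|].
  by have [le1 le2] := lanu c; lia.
(* One more than the bound for [la] and [mu], because [nu c.+1] also involves their parts of index
   [c]. *)
exists (maxn m n).+1 => -[//|c]; rewrite ltnS geq_max => /andP[le_mc le_nc].
by case: nuP => _ ->; rewrite la0 ?mu0 ?la0 ?mu0 //; lia.
Qed.

Lemma local_rule_uniq la mu ka k nu la' mu' ka' nu' :
  la =1 la' -> mu =1 mu' -> ka =1 ka' ->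
  local_rule la mu ka k nu -> local_rule la' mu' ka' k nu' -> nu =1 nu'.
Proof.
by move=> ela emu eka [nu0 nuS] [nu0' nuS'] [|c];
  rewrite ?nu0 ?nu0' ?nuS ?nuS' !ela !emu ?eka.
Qed.

(** * Grids of partitions *)

Definition local_grid (N : nat) (k : nat -> nat -> nat)
    (L : nat -> nat -> nat -> nat) :=
  [/\ forall a c, a <= N -> L a 0 c = 0,
      forall b c, b <= N -> L 0 b c = 0
    & forall a b, a < N -> b < N ->
      local_rule (L a b.+1) (L a.+1 b) (L a b) (k a.+1 b.+1) (L a.+1 b.+1)].

Lemma zero_partition l : (forall c, l c = 0) -> is_partition l.
Proof. by move=> l0; split=> [c|]; [|exists 0 => c]; rewrite !l0. Qed.

Lemma zero_interlace l m :
  (forall c, l c = 0) -> (forall c, m c = 0) -> interlace l m.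
Proof. by move=> l0 m0 c; rewrite l0 !m0. Qed.

Definition monotone_grid N (L : nat -> nat -> nat -> nat) :=
  [/\ forall a b, a <= N -> b <= N -> is_partition (L a b),
      forall a b, a < N -> b <= N -> interlace (L a b) (L a.+1 b)
    & forall a b, a <= N -> b < N -> interlace (L a b) (L a b.+1)].

(* The local rule is only required where its arguments are known to
   interlace, so that this covers both [local_grid] and [drag_grid]. *)
Lemma local_grid_monotone N k L :
  (forall a c, a <= N -> L a 0 c = 0) -> (forall b c, b <= N -> L 0 b c = 0) ->
  (forall a b, a < N -> b < N ->
     interlace (L a b) (L a b.+1) -> interlace (L a b) (L a.+1 b) ->
     local_rule (L a b.+1) (L a.+1 b) (L a b) (k a.+1 b.+1) (L a.+1 b.+1)) ->
  monotone_grid N L.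
Proof.
move=> La0 L0b Lrule.
suffices gridP a b : a <= N -> b <= N ->
    [/\ is_partition (L a b), 0 < a -> interlace (L a.-1 b) (L a b)
      & 0 < b -> interlace (L a b.-1) (L a b)].
  split=> a b le_a le_b; first by case: (gridP a b).
    by case: (gridP a.+1 b) => // _ /(_ isT).
  by case: (gridP a b.+1) => // _ _ /(_ isT).
elim: a b => [|a IHa] b le_a.
  move=> le_b; split=> // [|b_gt0].
    by apply: zero_partition => c; rewrite L0b.
  by apply: zero_interlace => c; rewrite L0b // (leq_trans (leq_pred _)).
elim: b => [|b IHb] le_b.
  split=> // [|_].
    by apply: zero_partition => c; rewrite La0.
  by apply: zero_interlace => c; rewrite La0 // ltnW.
have [_ _ /(_ isT) /= kala] := IHa b.+1 (ltnW le_a) le_b.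
have [_ /(_ isT) /= kamu _] := IHb (ltnW le_b).
have [la_part _ _] := IHa b.+1 (ltnW le_a) le_b.
have [mu_part _ _] := IHb (ltnW le_b).
have nuP := Lrule a b le_a le_b kala kamu.
have [lanu munu] := local_rule_interlace kala kamu nuP.
by split=> //; apply: local_rule_partition nuP.
Qed.

(** A single cell is governed by [dragP] only under interlacing, so interlacing is first propagated
    through the grid by [local_grid_monotone]. *)
Lemma drag_gridP N i1 i2 k L : drag_grid N i1 i2 k L <-> local_grid N k L.
Proof.
split=> [[La0 L0b Ldrag] | [La0 L0b Lrule]].
  have Ldrag' a b : a < N -> b < N ->
      interlace (L a b) (L a b.+1) -> interlace (L a b) (L a.+1 b) ->
      local_rule (L a b.+1) (L a.+1 b) (L a b) (k a.+1 b.+1) (L a.+1 b.+1).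
    move=> lt_a lt_b kala kamu.
    by apply/(dragP _ _ _ _ kala kamu); apply: (Ldrag a.+1 b.+1).
  have [_ kamu kala] := local_grid_monotone La0 L0b Ldrag'.
  by split=> // a b lt_a lt_b; apply: Ldrag';
    [| | apply: kala | apply: kamu]; rewrite // ltnW.
have [|_ kamu kala] := @local_grid_monotone N k L La0 L0b.
  by move=> a b lt_a lt_b _ _; apply: Lrule.
split=> // -[//|a] [//|b] lt_a lt_b; apply/dragP => /=; last exact: Lrule.
  by apply: kala; rewrite // ltnW.
by apply: kamu; rewrite // ltnW.
Qed.

Lemma local_grid_uniq N k L L' a b c :
  local_grid N k L -> local_grid N k L' -> a <= N -> b <= N ->
  L a b c = L' a b c.
Proof.
move=> [La0 L0b Lrule] [La0' L0b' Lrule'].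
elim: a b c => [|a IHa] b c le_a; first by move=> le_b; rewrite L0b ?L0b'.
elim: b c => [|b IHb] c le_b; first by rewrite La0 ?La0'.
have [le_a' le_b'] := (ltnW le_a, ltnW le_b).
apply: local_rule_uniq (Lrule a b le_a le_b) (Lrule' a b le_a le_b) c => c'.
- exact: IHa.
- exact: IHb.
- exact: IHa.
Qed.

(** * Row insertion *)

Notation count_le a := (count (fun z => z <= a)).

Lemma row_insert_sorted a r : sorted leq r -> sorted leq (row_insert a r).1.
Proof.
suffices row_path h s : h <= a -> path leq h s -> path leq h (row_insert a s).1.
  case: r => [|z r] //= r_path; case: ltnP => [lt_az | le_za] /=.
    by apply: path_le r_path => //; [exact: leq_trans | exact: ltnW].
  by have := row_path z r le_za r_path; case: row_insert.
elim: s h => [|z s IHs] h le_ha /=; first by rewrite le_ha.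
case/andP=> le_hz z_path; case: ltnP => [lt_az | le_za] /=.
  by rewrite le_ha (path_le leq_trans (ltnW lt_az)).
by have := IHs z le_za z_path; case: row_insert => s' o /= ->; rewrite le_hz.
Qed.

Lemma row_insert_perm a r :
  perm_eq (a :: r) ((row_insert a r).1 ++ seq_of_opt (row_insert a r).2).
Proof.
elim: r => [|z r IHr] //=; case: ifP => _ /=.
  by rewrite perm_cons cats1 perm_sym perm_rcons.
case: row_insert IHr => r' o /= IHr.
by rewrite (perm_catCA [:: a] [:: z] r) perm_cons.
Qed.

Lemma size_row_insert a r :
  size (row_insert a r).1 = size r + ((row_insert a r).2 == None).
Proof.
elim: r => [|z r IHr] //=; case: ifP => _ /=; first by rewrite addn0.
by case: row_insert IHr => r' o /= ->.
Qed.

Lemma row_insert_bumped a r y : sorted leq r -> (row_insert a r).2 = Some y ->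
  [/\ y \in r, a < y & forall u, u \in r -> a < u -> y <= u].
Proof.
elim: r => [|z r IHr] //= r_path; case: ltnP => [lt_az [<-] | le_za].
  rewrite mem_head; split=> // u; rewrite inE => /predU1P[-> //|].
  by move/(allP (order_path_min leq_trans r_path)).
case: row_insert (IHr (path_sorted r_path)) => r' o /= IHr'.
move/IHr'=> [yr lt_ay min_y].
rewrite inE yr orbT; split=> // u; rewrite inE => /predU1P[->|];
  last exact: min_y.
by rewrite ltnNge le_za.
Qed.

(** The letter [a] lands just after the entries at most [a]. For [a <= b], either it replaces an
    entry at most [b], and the count, already above [count_le a r], is unchanged; or no entry lies
    in between, and the count rises to [(count_le a r).+1]. *)
Lemma count_row_insert a r b : sorted leq r ->
  count_le b (row_insert a r).1 =
  if b < a then count_le b r else maxn (count_le b r) (count_le a r).+1.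
Proof.
have count_gt h s c : path leq h s -> c < h -> count_le c s = 0.
  move=> /(order_path_min leq_trans)/allP h_min lt_ch; apply/eqP.
  rewrite -leqn0 leqNgt -has_count; apply/hasPn => u /h_min; rewrite -ltnNge.
  exact: leq_trans.
elim: r => [|z r IHr] /=; first by case: ltnP.
move=> r_path; have [cb ca] := (@count_gt z r b r_path, @count_gt z r a r_path).
case: ltnP => [lt_az | le_za] /=.
  rewrite ca //=; case: (leqP z b) cb => [le_zb _ | lt_bz -> //].
    by case: ltnP; lia.
  by case: ltnP.
case: row_insert (IHr (path_sorted r_path)) => r' o /= ->.
by case: ltnP => // le_ab; rewrite (leq_trans le_za le_ab); lia.
Qed.

(** * Inserting a word into one row *)

Fixpoint row_inserts (w r : seq nat) : seq nat * seq nat :=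
  if w is a :: w' then
    let: (r', o) := row_insert a r in
    let: (r'', v) := row_inserts w' r' in (r'', seq_of_opt o ++ v)
  else (r, [::]).

Lemma row_inserts_cons a w r :
  row_inserts (a :: w) r =
  ((row_inserts w (row_insert a r).1).1,
   seq_of_opt (row_insert a r).2 ++ (row_inserts w (row_insert a r).1).2).
Proof. by rewrite /=; case: row_insert => r' o /=; case: row_inserts. Qed.

Lemma row_inserts_sorted w r : sorted leq r -> sorted leq (row_inserts w r).1.
Proof.
elim: w r => [|a w IHw] r // r_sorted.
by rewrite row_inserts_cons; apply/IHw/row_insert_sorted.
Qed.

Lemma row_inserts_perm w r :
  perm_eq (r ++ w) ((row_inserts w r).1 ++ (row_inserts w r).2).
Proof.
elim: w r => [|a w IHw] r //; apply/permP => p; rewrite row_inserts_cons /=.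
have /permP/(_ p) := row_insert_perm a r.
have /permP/(_ p) := IHw (row_insert a r).1.
by rewrite !count_cat /= => ? ?; lia.
Qed.

Lemma row_inserts_foldl w r :
  (row_inserts w r).1 = foldl (fun r a => (row_insert a r).1) r w.
Proof. by elim: w r => [|a w IHw] r //; rewrite row_inserts_cons /= IHw. Qed.

Lemma row_inserts_rcons w a r :
  (row_inserts (rcons w a) r).1 = (row_insert a (row_inserts w r).1).1.
Proof. by rewrite !row_inserts_foldl foldl_rcons. Qed.

Lemma count_leS b s : count_le b.+1 s = count_le b s + count_mem b.+1 s.
Proof.
by elim: s => //= z s ->; rewrite leq_eqVlt ltnS;
  case: (ltngtP z b.+1) => /=; lia.
Qed.

(** Induction on the last letter [z], the largest. It changes neither count if [z] exceeds [b.+1],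
    adds one to the left count if equal, and otherwise enters both maxima in the same way. *)
Lemma count_row_inserts w r b : sorted leq w -> sorted leq r ->
  count_le b.+1 (row_inserts w r).1 =
  count_mem b.+1 w
  + maxn (count_le b (row_inserts w r).1) (count_le b.+1 r).
Proof.
move=> w_sorted r_sorted; elim/last_ind: w w_sorted => [_|w z IHw wz_sorted].
  by rewrite /= count_leS; lia.
move: wz_sorted; rewrite (sorted_pairwise leq_trans) pairwise_rcons.
case/andP=> /allP le_wz; rewrite -(sorted_pairwise leq_trans) => /IHw{IHw}.
rewrite row_inserts_rcons !count_row_insert ?row_inserts_sorted //.
rewrite -cats1 count_cat /= addn0.
have [lt_bz|lt_zb|->] := ltngtP b.+1 z.
- by lia.
- rewrite (count_memPn _); last by apply/negP => /le_wz; lia.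
  by lia.
- by lia.
Qed.

(** Insertion conserves the copies of [b.+1] in row and word together; subtracting those left in the
    new row turns the maximum of [count_row_inserts] into a minimum. *)
Lemma count_bumped w r b : sorted leq w -> sorted leq r ->
  count_mem b.+1 (row_inserts w r).2 + count_le b r =
  minn (count_le b (row_inserts w r).1) (count_le b.+1 r).
Proof.
move=> w_sorted r_sorted; have := count_row_inserts b w_sorted r_sorted.
have /permP/(_ (pred1 b.+1)) := row_inserts_perm w r.
by rewrite !count_cat !count_leS; lia.
Qed.

(* The threshold z moves along w: a letter of w inserted earlier may lie
   between z and y, but never above the current letter. *)
Lemma bumped_path z y w r : sorted leq r -> path leq z w ->
    (forall u, u \in r -> z < u -> y <= u) ->
  path leq y (row_inserts w r).2.
Proof.
elim: w z y r => [|a w IHw] z y r // r_sorted.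
rewrite row_inserts_cons => /andP[le_za a_path] min_y.
have sub_r u : u \in (row_insert a r).1 -> a < u -> u \in r.
  move=> u_r lt_au; have := perm_mem (row_insert_perm a r) u.
  by rewrite mem_cat u_r inE gtn_eqF.
have sorted_r := row_insert_sorted a r_sorted.
case E: (row_insert a r).2 => [v|] /=.
  have [vr lt_av min_v] := row_insert_bumped r_sorted E.
  rewrite min_y ?(leq_ltn_trans le_za) //=.
  by apply: (IHw a) => // u /sub_r ur lt_au; apply: min_v; rewrite // ur.
apply: (IHw a) => // u /sub_r ur lt_au.
by apply: min_y; rewrite ?ur ?(leq_ltn_trans le_za).
Qed.

Lemma bumped_sorted w r : sorted leq w -> sorted leq r ->
  sorted leq (row_inserts w r).2.
Proof.
move=> w_sorted r_sorted; apply: (@path_sorted _ _ 0).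
by apply: (@bumped_path 0) => //; case: w w_sorted.
Qed.

(** * Inserting a word into a tableau *)

Definition tab_inserts (w : seq nat) (P : tableau) : tableau :=
  foldl (fun P a => (tab_insert a P).1) P w.

Lemma tab_insertE a P :
  (tab_insert a P).1 =
  (row_insert a (head [::] P)).1
    :: tab_inserts (seq_of_opt (row_insert a (head [::] P)).2) (behead P).
Proof.
case: P => //= r P; case: row_insert => r' [z|] //=.
by case: tab_insert.
Qed.

(** The first row never sees the rows below, which receive its bumped letters in order. Using [head]
    and [behead] treats a missing row as an empty one. *)
Lemma tab_insertsE w P :
  head [::] (tab_inserts w P) = (row_inserts w (head [::] P)).1 /\
  behead (tab_inserts w P)
    = tab_inserts (row_inserts w (head [::] P)).2 (behead P).
Proof.
elim: w P => [|a w IHw] P //; rewrite row_inserts_cons.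
have [] := IHw (tab_insert a P).1; rewrite {1 2}/tab_inserts /= => -> ->.
by rewrite tab_insertE /= /tab_inserts foldl_cat.
Qed.

Definition sorted_rows (P : tableau) := forall c, sorted leq (nth [::] P c).

Lemma sorted_rows_behead P : sorted_rows P -> sorted_rows (behead P).
Proof. by move=> sP c; rewrite nth_behead. Qed.

Lemma tab_inserts_sorted w P :
  sorted_rows P -> sorted_rows (tab_inserts w P).
Proof.
move=> sP c; elim: c w P sP => [|c IHc] w P sP.
  by rewrite nth0 (tab_insertsE w P).1 row_inserts_sorted // -nth0.
by rewrite -nth_behead (tab_insertsE w P).2; apply/IHc/sorted_rows_behead.
Qed.

(** Row 0 is [count_row_inserts]. Row 1 is the first row of [behead P], entered by the bumped word,
    whose multiplicities [count_bumped] supplies. Deeper rows follow by induction, replacing [w] by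
    the bumped word. *)
Lemma tab_inserts_local_rule w P b : sorted leq w -> sorted_rows P ->
  let m P a c := count_le a (nth [::] P c) in
  local_rule (m (tab_inserts w P) b) (m P b.+1) (m P b) (count_mem b.+1 w)
    (m (tab_inserts w P) b.+1).
Proof.
move=> sw sP m.
have first_row v T : sorted leq v -> sorted_rows T ->
    m (tab_inserts v T) b.+1 0
    = count_mem b.+1 v + maxn (m (tab_inserts v T) b 0) (m T b.+1 0).
  move=> sv sT; rewrite /m !nth0 (tab_insertsE v T).1.
  by rewrite count_row_inserts // -nth0.
split=> [|c]; first exact: first_row.
elim: c w P sw sP => [|c IHc] w P sw sP; have sbP := sorted_rows_behead sP.
all: have sv : sorted leq (row_inserts w (nth [::] P 0)).2.
1,3: exact: bumped_sorted.
all: have [head_w behead_w] := tab_insertsE w P.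
all: rewrite -!nth0 in head_w behead_w.
  have := count_bumped b sw (sP 0); have := first_row _ _ sv sbP.
  by rewrite /m head_w -behead_w !nth_behead; lia.
have := IHc _ _ sv sbP.
by rewrite -behead_w /m !nth_behead.
Qed.

Lemma tab_insert_all (p : pred nat) a P :
  p a -> all (all p) P -> all (all p) (tab_insert a P).1.
Proof.
elim: P a => [|r P IHP] a /= pa; first by rewrite pa.
case/andP=> pr pP; have := perm_all p (row_insert_perm a r).
rewrite all_cat /= pa pr; case: row_insert => r' [z|] /= /esym/andP[pr' pz].
  move: pz; rewrite andbT => /IHP/(_ pP).
  by case: tab_insert => P' i /= ->; rewrite pr'.
by rewrite pr'.
Qed.

Lemma tab_inserts_all (p : pred nat) w P :
  all p w -> all (all p) P -> all (all p) (tab_inserts w P).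
Proof.
elim: w P => [|a w IHw] P //= /andP[pa pw] pP.
by apply: IHw => //; apply: tab_insert_all.
Qed.

Lemma size_tab_insert a P r :
  size (nth [::] (tab_insert a P).1 r)
  = size (nth [::] P r) + (r == (tab_insert a P).2).
Proof.
elim: P a r => [|s P IHP] a r /=; first by case: r => [|r]; rewrite //= nth_nil.
have := size_row_insert a s; case: row_insert => s' [z|] /= size_s.
  have := IHP z; case: tab_insert => P' i /= IHP'; case: r => [|r] //=.
by case: r => [|r] //=; rewrite addn0.
Qed.

(** * RSK, one upper letter at a time *)

Lemma rsk_steps_fst b w PQ :
  (foldl rsk_step PQ [seq (b, a) | a <- w]).1 = tab_inserts w PQ.1.
Proof.
elim: w PQ => [|a w IHw] [P Q] //=; rewrite IHw.
by rewrite /rsk_step /= /tab_inserts /=; case: tab_insert.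
Qed.

(** Each insertion lengthens one row of the first tableau, and the same row of the second receives
    [b] at its end; hence a common [d]. *)
Lemma rsk_steps_snd b w PQ r :
  let PQ' := foldl rsk_step PQ [seq (b, a) | a <- w] in
  exists d, size (nth [::] PQ'.1 r) = size (nth [::] PQ.1 r) + d /\
            nth [::] PQ'.2 r = nth [::] PQ.2 r ++ nseq d b.
Proof.
elim: w PQ => [|a w IHw] [P Q] /=; first by exists 0; rewrite addn0 cats0.
have [d [-> ->]] := IHw (rsk_step (P, Q) (b, a)); rewrite /rsk_step /=.
have := size_tab_insert a P r; case: tab_insert => P' i /= ->.
rewrite /record_entry nth_set_nth /=; exists ((r == i) + d); rewrite addnA.
by split=> //; case: eqP => [->|_] //=; rewrite cat_rcons.
Qed.

Definition column_word (N : nat) (k : nat -> nat -> nat) (b : nat) :=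
  flatten [seq nseq (k a b) a | a <- iota 1 N].

Definition rsk_upto N k b : tableau * tableau :=
  foldl rsk_step ([::], [::])
    (flatten [seq [seq (b', a) | a <- column_word N k b'] | b' <- iota 1 b]).

Lemma rskE N k : rsk N k = rsk_upto N k N.
Proof.
rewrite /rsk /rsk_upto /biword; congr (foldl _ _ (flatten _)).
apply: eq_map => b; rewrite /column_word map_flatten -map_comp; congr flatten.
by apply: eq_map => a /=; rewrite map_nseq.
Qed.

Lemma rsk_uptoS N k b :
  rsk_upto N k b.+1 =
  foldl rsk_step (rsk_upto N k b) [seq (b.+1, a) | a <- column_word N k b.+1].
Proof.
rewrite /rsk_upto; have -> : iota 1 b.+1 = iota 1 b ++ [:: b.+1].
  by rewrite -{1}(addn1 b) iotaD.
by rewrite map_cat flatten_cat foldl_cat /= cats0.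
Qed.

Lemma rsk_uptoS_fst N k b :
  (rsk_upto N k b.+1).1 = tab_inserts (column_word N k b.+1) (rsk_upto N k b).1.
Proof. by rewrite rsk_uptoS rsk_steps_fst. Qed.

Lemma column_word_sorted N k b : sorted leq (column_word N k b).
Proof.
suffices word_path m :
    path leq m (flatten [seq nseq (k a b) a | a <- iota m N]).
  exact: path_sorted (word_path 1).
elim: N m => [|N IHN] m //=; rewrite cat_path.
have path_nseq n : path leq m (nseq n m) by elim: n => //= n ->; rewrite leqnn.
have last_nseq n : last m (nseq n m) = m by elim: n.
by rewrite path_nseq last_nseq (path_le leq_trans (leqnSn m)).
Qed.

Lemma column_word_letters N k b :
  all (fun a => 0 < a <= N) (column_word N k b).
Proof.
apply/allP => a /flatten_mapP[a']; rewrite mem_iota => le_a' /nseqP[-> _].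
by move: le_a'; lia.
Qed.

Lemma count_column_word N k a b :
  a < N -> count_mem a.+1 (column_word N k b) = k a.+1 b.
Proof.
suffices count_word m n : count_mem a.+1
    (flatten [seq nseq (k a b) a | a <- iota m n])
    = (m <= a.+1 < m + n) * k a.+1 b.
  move=> lt_a; rewrite /column_word count_word.
  by have -> : (0 < a.+1 < 1 + N) = true by []; rewrite mul1n.
elim: n m => [|n IHn] m /=; first by rewrite addn0 leqNgt andNb.
rewrite count_cat count_nseq IHn addSnnS /=.
have [-> | ne_ma] := eqVneq m a.+1; last by rewrite ltn_neqAle ne_ma.
by rewrite ltnn leqnn -addSnnS leq_addr addn0.
Qed.

Lemma rsk_upto_sorted N k b : sorted_rows (rsk_upto N k b).1.
Proof.
elim: b => [|b IHb]; first by move=> c; rewrite nth_nil.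
by rewrite rsk_uptoS_fst; apply: tab_inserts_sorted.
Qed.

Lemma rsk_upto_letters N k b r :
  all (fun a => 0 < a <= N) (nth [::] (rsk_upto N k b).1 r).
Proof.
suffices: all (all (fun a => 0 < a <= N)) (rsk_upto N k b).1.
  by move=> allP'; case: (ltnP r (size (rsk_upto N k b).1)) => [lt_r | le_r];
     [exact: (all_nthP _ allP') | rewrite nth_default].
elim: b => [|b IHb] //; rewrite rsk_uptoS_fst.
exact: tab_inserts_all (column_word_letters _ _ _) IHb.
Qed.

(** Rows being sorted, this is the shape occupied by the letters at most [a] after the upper letters
    up to [b]: the growth diagram of RSK. *)
Definition rsk_grid N k a b r := count_le a (nth [::] (rsk_upto N k b).1 r).

Lemma rsk_local_grid N k : local_grid N k (rsk_grid N k).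
Proof.
split=> [a c _ | b c _ | a b lt_a _].
- by rewrite /rsk_grid /= nth_nil.
(* All letters are positive, so none is at most 0. *)
- rewrite /rsk_grid; apply/eqP; rewrite -leqn0 leqNgt -has_count; apply/hasPn.
  by move=> u /(allP (rsk_upto_letters _ _ _ _)); rewrite leqn0; case: u.
have := @tab_inserts_local_rule _ _ a (column_word_sorted N k b.+1)
  (rsk_upto_sorted N k b).
by rewrite -rsk_uptoS_fst count_column_word.
Qed.

(** * Reading the two tableaux off the grid *)

Lemma ltn_count_le s a c : sorted leq s ->
  (c < count_le a s) = (c < size s) && (nth 0 s c <= a).
Proof.
elim: s c => [|z s IHs] //= c s_path.
have s_min := order_path_min leq_trans s_path.
case: (leqP z a) => [le_za | lt_az].
  by case: c => [|c] /=; rewrite add1n ltnS ?le_za // IHs ?(path_sorted s_path).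
rewrite (@eq_in_count _ _ pred0) ?count_pred0 ?ltn0; last first.
  by move=> u /(allP s_min) /=; lia.
case: c => [|c] /=; first by lia.
by case: ltnP => //= lt_c; have := all_nthP 0 s_min c lt_c; lia.
Qed.

Lemma onth_sortedP s a c : sorted leq s ->
  onth s c = Some a.+1 <-> count_le a s <= c < count_le a.+1 s.
Proof.
move=> s_sorted; rewrite leqNgt !ltn_count_le //; case: (ltnP c (size s)) => /=.
  move=> lt_c; rewrite -ltnNge -eqn_leq onthE (nth_map 0) //.
  by split=> [[<-] // | /eqP->].
by move=> le_c; rewrite onth_default.
Qed.

Lemma rsk_insertion_filled N k :
  filled_by N (fun a => rsk_grid N k a N) (rsk N k).1.
Proof.
rewrite rskE => r c a.
have [srt ltr] := (rsk_upto_sorted N k N r, rsk_upto_letters N k N r).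
have letter_in x :
    onth (nth [::] (rsk_upto N k N).1 r) c = Some x -> 0 < x <= N.
  by move=> e; apply: (allP ltr x); apply/onthP; exists c.
case: a => [|a]; first by split=> [/letter_in | []].
rewrite onth_sortedP //; split=> [lt_c | []//]; split=> //.
by apply: letter_in; apply/onth_sortedP.
Qed.

Lemma rsk_grid_size N k b r :
  rsk_grid N k N b r = size (nth [::] (rsk_upto N k b).1 r).
Proof.
apply/eqP; rewrite -all_count; apply: sub_all (rsk_upto_letters N k b r).
by move=> a /andP[].
Qed.

(** Rows of the two tableaux keep equal lengths, so the copies of [b.+1] occupy exactly the columns
    between the lengths at stages [b] and [b.+1]. *)
Lemma rsk_recording_filled N k :
  filled_by N (fun b => rsk_grid N k N b) (rsk N k).2.
Proof.
rewrite rskE => r c a.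
suffices recP b : size (nth [::] (rsk_upto N k b).2 r) = rsk_grid N k N b r /\
    (onth (nth [::] (rsk_upto N k b).2 r) c = Some a <->
     (0 < a <= b) /\ (rsk_grid N k N a.-1 r <= c < rsk_grid N k N a r)).
  by case: (recP N).
elim: b => [|b [size_b onth_b]].
  rewrite rsk_grid_size /= nth_nil onth0n; split=> //; split=> // -[]; lia.
have [d []] := rsk_steps_snd b.+1 (column_word N k b.+1) (rsk_upto N k b) r.
rewrite -rsk_uptoS -!rsk_grid_size => size_P ->.
rewrite size_cat size_nseq size_b size_P; split=> //.
rewrite onth_cat onth_nseq size_b; case: ltnP => [lt_c | le_c].
  rewrite onth_b; split=> -[le_a c_in]; split=> //; first by lia.
  suffices : a != b.+1 by lia.
  by apply: contraTneq c_in => -> /=; lia.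
split=> [|[le_a c_in]].
  case: ifP => // lt_c [<-]; rewrite /= ltnS leqnn size_P; split=> //; lia.
(* A smaller [a] would, by induction, give an entry in column [c], beyond the end of the old row. *)
have ab : a = b.+1.
  apply/eqP; apply/negPn/negP => ne_ab.
  have /onth_b e : (0 < a <= b) /\
      (rsk_grid N k N a.-1 r <= c < rsk_grid N k N a r) by split=> //; lia.
  by have := onthTE (nth [::] (rsk_upto N k b).2 r) c;
     rewrite e size_b /=; lia.
by move: c_in; rewrite ab /= size_P => c_in; rewrite ifT //; lia.
Qed.

Lemma filled_by_eq N M M' T :
  (forall a r, a <= N -> M a r = M' a r) -> filled_by N M T -> filled_by N M' T.
Proof.
move=> eM fT r c a; rewrite fT; split=> -[le_a].
  by rewrite !eM //; lia.
by rewrite -!eM //; lia.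
Qed.

Theorem proposition3p5 :
  (forall (la mu ka : nat -> nat) (k i1 i2 : nat),
     is_partition la -> is_partition mu -> is_partition ka ->
     interlace ka la -> interlace ka mu ->
     exists nu : nat -> nat,
       [/\ unique (drag_first i1 i2 la mu ka k) (nu 0),
           forall c, unique (drag_column la mu ka c (nu c)) (nu c.+1),
           nu 0 = k + maxn (la 0) (mu 0)
         & forall c, nu c.+1 =
             maxn (la c.+1) (mu c.+1) + minn (la c) (mu c) - ka c])
  /\
  (forall (N : nat) (k i1 i2 : nat -> nat -> nat),
     (exists L, drag_grid N i1 i2 k L) /\
     forall L, drag_grid N i1 i2 k L ->
       [/\ forall a b, a <= N -> b <= N -> is_partition (L a b),
           forall a b, 1 <= a <= N -> 1 <= b <= N ->
             interlace (L a.-1 b.-1) (L a.-1 b) /\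
             interlace (L a.-1 b.-1) (L a b.-1),
           filled_by N (fun a => L a N) (rsk N k).1
         & filled_by N (fun b => L N b) (rsk N k).2]).

Proof.
split=> [la mu ka k i1 i2 _ _ _ kala kamu | N k i1 i2].
  pose nu c := if c is c'.+1
    then maxn (la c) (mu c) + minn (la c') (mu c') - ka c'
    else k + maxn (la 0) (mu 0).
  have nuP : local_rule la mu ka k nu by [].
  have [d0 dS] : drag i1 i2 la mu ka k nu by apply/dragP.
  have [[la0 _] [mu0 _]] := (kala 0, kamu 0).
  exists nu; split=> //.
    by split=> // n /drag_firstP ->.
  move=> c; split=> // n.
  by move/(drag_columnP _ kala kamu (local_rule_ge c kala kamu nuP)) => ->.
(* The RSK shapes provide existence; by [local_grid_uniq] every dragged grid agrees with them, so
   both fillings transfer to it. *)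
have gridP := rsk_local_grid N k.
split; first by exists (rsk_grid N k); apply/drag_gridP.
move=> L /drag_gridP LP.
have eqL a b c (le_a : a <= N) (le_b : b <= N) : rsk_grid N k a b c = L a b c.
  exact: local_grid_uniq gridP LP le_a le_b.
have [La0 L0b Lrule] := LP.
have [|Lpart kamu kala] := @local_grid_monotone N k L La0 L0b.
  by move=> a b lt_a lt_b _ _; apply: Lrule.
split=> //.
- by move=> [|a] [|b] //= le_a le_b; split; [apply: kala | apply: kamu];
     rewrite // ltnW.
- apply: filled_by_eq (rsk_insertion_filled N k) => a r le_a; exact: eqL.
- apply: filled_by_eq (rsk_recording_filled N k) => b r le_b; exact: eqL.
Qed.
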